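(* Let $\alpha$ be a positive integer satisfying $\alpha\le\max G$. Assume that $\Omega_G(n)\neq0$ for $n=0,1,2,\ldots$. (1) If the real numbers $\kappa_i^g$ ($i=0,\ldots,m-1$, $g\in G$) satisfy, for each $i=0,\ldots,m-1$, $$\sum_{g\in G}\kappa_i^g\mathcal{R}_g(-j)=0\quad (j=1,\ldots,m-1-i),\qquad \sum_{g\in G}\kappa_i^g\mathcal{R}_g(-m+i)\neq 0,$$ then for every $n\ge0$ $$\langle q_n,q_i\rangle_\xi=0,\quad i=0,\ldots,n-1,\qquad\qquad\langle q_n,q_n\rangle_\xi\neq0 .$$ (2) With no assumptions on the real numbers $\kappa_j^g$, $j=0,\ldots,m-1$, $g\in G$, one always has $$\langle q_n(x),x^i\rangle_\xi=0,\qquad n\ge m,\quad 0\le i\le n-1 .$$ Here $\langle\cdot,\cdot\rangle_\xi$ is the bilinear form (depending on the numbers $\kappa_i^g$) defined in the context.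
   Context: The Laguerre polynomials are $L_n^{\alpha}(x)=\sum_{j=0}^n\frac{(-x)^j}{j!}\binom{n+\alpha}{n-j}$ for $n\ge 0$, and $L_n^\alpha=0$ for $n<0$. Here $\binom{y}{k}=y(y-1)\cdots(y-k+1)/k!$ and $(a)_k=a(a+1)\cdots(a+k-1)$ with $(a)_0=1$. $G=\{g_1<g_2<\cdots<g_m\}$ is a finite set of $m\ge 1$ positive integers and, for each $g\in G$, $\mathcal{R}_g$ is a real polynomial of degree $g$ with leading coefficient $1/g!$. Put $\Omega_G(x)=\det\left(\mathcal{R}_{g_l}(x-j)\right)_{l,j=1}^m$. The polynomials $(q_n)_{n\ge 0}$ are defined by $$q_n(x)=\begin{vmatrix} L^\alpha_n(x) & L^\alpha_{n-1}(x) & \cdots & L^\alpha_{n-m}(x)\\ \mathcal{R}_{g_1}(n)&\mathcal{R}_{g_1}(n-1)&\cdots&\mathcal{R}_{g_1}(n-m)\\ \vdots&\vdots&\ddots&\vdots\\ \mathcal{R}_{g_m}(n)&\mathcal{R}_{g_m}(n-1)&\cdots&\mathcal{R}_{g_m}(n-m)\end{vmatrix}.$$ Write $\mathcal{R}_g(x)=\sum_{l=0}^g w_l^g\binom{x+l}{l}$ (this determines $w_l^g$ uniquely, and $w_g^g=1$). For $a>-1$ let $\mu_a=x^ae^{-x}$ on $(0,\infty)$. Put $\xi_M=\max\{0,m-\alpha\}$ and $\xi_m=-\min\{0,m-\alpha\}$. Given real numbers $\kappa_i^g$, define for $i=0,\ldots,m-1$ and $g\in G$ $$U_{i,\xi}^g(x)=(i-m+\alpha+1)_{\xi_M}\frac{-x^{-m+i}}{m}+\kappa_i^g\sum_{l=0}^g(\alpha-l)_l\,w_l^g\,x^{-l-1},$$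 and, for $g\ge\alpha$, $$V_{i,\xi}^g(x)=(i-m+\alpha+1)_{\xi_M}\frac{-x^{-m+i}}{m}+\kappa_i^g\sum_{l=0}^{\alpha-1}(\alpha-l)_l\,w_l^g\,x^{-l-1}$$ (terms with zero coefficient are dropped). The bilinear form on real polynomials is $$\langle p,q\rangle_\xi=\int_0^\infty p(x)q^{(\xi_M)}(x)\mu_{\xi_m}\,dx+\sum_{i=0}^{m-1}\frac{q^{(i)}(0)}{i!}\int_0^\infty p(x)\Big(\sum_{g\in G;\,g<\alpha}U_{i,\xi}^g(x)+\sum_{g\in G;\,g\ge\alpha}V_{i,\xi}^g(x)\Big)\mu_\alpha\,dx$$ $$\qquad+\Gamma(\alpha)\sum_{i=0}^{m-1}\frac{q^{(i)}(0)}{i!}\sum_{g\in G;\,g\ge\alpha}\kappa_i^g\sum_{j=0}^{g-\alpha}\frac{p^{(j)}(0)}{j!}\sum_{l=\alpha+j}^g(\alpha-l)_j\,w_l^g .$$ *)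

(* Defs.v *)
From HB Require Import structures.
From mathcomp Require Import all_boot all_order all_algebra.
From mathcomp Require Import all_classical all_reals all_analysis.

Set Implicit Arguments.
Unset Strict Implicit.
Unset Printing Implicit Defensive.

Import Order.TTheory GRing.Theory Num.Theory.
Import numFieldNormedType.Exports.

Local Open Scope classical_set_scope.
Local Open Scope ring_scope.

Definition gbinom (R : realType) (y : R) (k : nat) : R :=
  (\prod_(i < k) (y - i%:R)) / k`!%:R.

Definition poch (R : realType) (a : R) (k : nat) : R :=
  \prod_(i < k) (a + i%:R).

(* The degree is an integer, so that L_n^a = 0 for n < 0. *)
Definition laguerre (R : realType) (a : R) (n : int) : {poly R} :=
  match n with
  | Posz n =>
      \sum_(j < n.+1) (gbinom (n%:R + a) (n - j) / j`!%:R) *: (- 'X) ^+ j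
  | Negz _ => 0
  end.

(* Throughout, the set {g_1 < ... < g_m} is a strictly increasing sequence G of
   naturals, m is size G, and g_l is the entry of G at index l - 1.  The family
   Rg is only used at the elements of G. *)

Definition Omega (R : realType) (G : seq nat) (Rg : nat -> {poly R}) (x : R)
    : R :=
  \det (\matrix_(l < size G, j < size G) (Rg (nth 0%N G l)).[x - j.+1%:R]).

Definition qdet (R : realType) (a : R) (G : seq nat) (Rg : nat -> {poly R})
    (n : nat) : {poly R} :=
  \det (col_mx
    (\row_(j < 1 + size G) laguerre a (n%:Z - j%:Z))
    (\matrix_(l < size G, j < 1 + size G)
       ((Rg (nth 0%N G l)).[n%:R - j%:R])%:P)).

(* w g l stands for w_l^g; the equation determines it for l <= g, and only
   these values occur in the bilinear form. *)
Definition binom_expansion (R : realType) (G : seq nat) (Rg : nat -> {poly R})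
    (w : nat -> nat -> R) : Prop :=
  forall g, g \in G ->
  forall x : R, (Rg g).[x] = \sum_(l < g.+1) w g l * gbinom (x + l%:R) l.

(* Density of mu_a on the positive half-line. *)
Definition mudens (R : realType) (a : R) (x : R) : R :=
  x `^ a * expR (- x).

(* Euler's integral, for a > 0. *)
Definition EulerGamma (R : realType) (a : R) : R :=
  \int[@lebesgue_measure R]_(x in `]0, +oo[) (x `^ (a - 1) * expR (- x)).

(* max{0, m - alpha} and - min{0, m - alpha}: subtraction on nat truncates. *)
Definition xiM (m alpha : nat) : nat := (m - alpha)%N.
Definition xim (m alpha : nat) : nat := (alpha - m)%N.

(* When i - m + alpha < 0, the Pochhammer factor vanishes, so the singular
   first term is identically 0, as it should be. *)
Definition Ufun (R : realType) (alpha m : nat) (w kappa : nat -> nat -> R)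
    (i g : nat) (x : R) : R :=
  poch (i%:R - m%:R + alpha%:R + 1) (xiM m alpha)
    * (- x ^ (i%:Z - m%:Z) / m%:R)
  + kappa i g
    * \sum_(l < g.+1) poch (alpha%:R - l%:R) l * w g l * x ^ (- l%:Z - 1).

Definition Vfun (R : realType) (alpha m : nat) (w kappa : nat -> nat -> R)
    (i g : nat) (x : R) : R :=
  poch (i%:R - m%:R + alpha%:R + 1) (xiM m alpha)
    * (- x ^ (i%:Z - m%:Z) / m%:R)
  + kappa i g
    * \sum_(l < alpha) poch (alpha%:R - l%:R) l * w g l * x ^ (- l%:Z - 1).

Definition xiform (R : realType) (alpha : nat) (G : seq nat)
    (w kappa : nat -> nat -> R) (p q : {poly R}) : R :=
  let m := size G in
  \int[@lebesgue_measure R]_(x in `]0, +oo[)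
     (p.[x] * (q^`(xiM m alpha)).[x] * mudens (xim m alpha)%:R x)
  + \sum_(i < m) (q^`(i)).[0] / i`!%:R
      * (\int[@lebesgue_measure R]_(x in `]0, +oo[)
           (p.[x]
            * (\sum_(g <- G | (g < alpha)%N) Ufun alpha m w kappa i g x
               + \sum_(g <- G | (alpha <= g)%N) Vfun alpha m w kappa i g x)
            * mudens alpha%:R x))
  + EulerGamma alpha%:R
    * \sum_(i < m) (q^`(i)).[0] / i`!%:R
        * \sum_(g <- G | (alpha <= g)%N) kappa i g
            * \sum_(0 <= j < (g - alpha).+1) (p^`(j)).[0] / j`!%:R
                * \sum_(alpha + j <= l < g.+1)
                    poch (alpha%:R - l%:R) j * w g l.

(* Main.v *)
Require Import Defs.
From HB Require Import structures.
From mathcomp Require Import all_boot all_order all_algebra.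
From mathcomp Require Import all_classical all_reals all_analysis.
From mathcomp Require Import measurable_realfun ring zify.

(** Every integral in the bilinear form is the integral of a polynomial against
    [e^-x]: the apparently singular powers of [x] either carry a vanishing
    Pochhammer coefficient or are absorbed by the weight [x^alpha].  So the form
    can be computed from [int_0^oo x^k e^-x dx = k!] alone.

    Write [q_i] for the coefficients of [q] and [m] for [size G].  For [i < m],
    the first summands of [U] and [V], once added over the [m] elements of [G],
    cancel the contribution of [q_i] to the first integral of the form.  What
    remains ([xiformE]) is
      sum_(i >= m) q_i (i-m+alpha+1)_xiM int_0^oo p(x) x^(i-m+alpha) e^-x dx
      + sum_(i < m) q_i sum_(g in G) kappa_i^g Lambda_g(p)
    where the functional [Lambda_g = sum_l w_l^g rho_l] collects both the
    integrals and the discrete part of the form.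

    The functional [rho_l] ([gamma_power]) is [Gamma(alpha)] times the
    distribution [x_+^(alpha-l-1) e^-x / Gamma(alpha-l)], which for
    [l >= alpha], at a pole of Gamma, is a derivative of the delta at 0.
    In both cases, [rho_l(L_n^alpha) = (alpha-1)! binom(n+l,l)]
    ([gamma_power_laguerre]) by the Vandermonde identity, and therefore
    [Lambda_g(L_n^alpha) = (alpha-1)! R_g(n)] for [n >= 0].

    Expanding the determinant along its first row gives
    [q_n = sum_j beta_j L_(n-j)^alpha], where [beta_0 = Omega_G(n)],
    [beta_m = (-1)^m Omega_G(n+1)], and [sum_j beta_j R_g(n-j) = 0] because a
    determinant with two equal rows vanishes.  Hence [q_n] has degree [n], and
    [Lambda_g(q_n)] is, up to a constant, the sum of [beta_j R_g(n-j)] over the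
    indices with [n - j < 0], for which the Laguerre polynomial is 0
    ([R_functional_qdet]).

    If [n >= m], no such index exists: all the [Lambda_g(q_n)] are 0, and
    the orthogonality of the Laguerre polynomials, applied with powers of degree
    at most [n - m], shows that the form at [(q_n, q)] is a nonzero multiple of
    the coefficient of [x^n] in [q], for every [q] of degree at most [n]
    ([xiform_qdet_ge]).  If [n < m], the first sum is empty, and the conditions
    on [kappa] annihilate every term of the second one but the term [i = n],
    [j = m] ([xiform_qdet_lt]); the same conclusion holds.  Taking for [q]
    a power of [x] or one of the [q_i] proves both parts. *)

Set Implicit Arguments.
Unset Strict Implicit.
Unset Printing Implicit Defensive.

Import Order.TTheory GRing.Theory Num.Theory.
Import numFieldNormedType.Exports.

Local Open Scope ring_scope.

(** * Integration of polynomials against the exponential weight *)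

Local Open Scope classical_set_scope.

Lemma factr_neq0 (R : realType) k : k`!%:R != 0 :> R.
Proof. by rewrite pnatr_eq0 -lt0n fact_gt0. Qed.

(** From [x^(k+1) / (k+1)! <= e^x], the function is at most [(k+1)! / x]. *)
Lemma cvg_expr_expRN (R : realType) k :
  (x ^+ k * expR (- x)) @[x --> +oo] --> (0 : R).
Proof.
have lim0 : (k.+1`!%:R * x^-1 : R) @[x --> +oo] --> (0 : R).
  rewrite -(mulr0 (k.+1`!%:R : R)); apply: cvgMr.
  by apply/gtr0_cvgV0; [exact: nbhs_pinfty_gt|exact: cvg_id].
apply: squeeze_cvgr lim0; last exact: cvg_cst; near=> x.
have x0 : 0 < x by [].
rewrite mulr_ge0 ?exprn_ge0 ?expR_ge0 ?(ltW x0)//=.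
rewrite expRN ler_pdivrMr ?expR_gt0// mulrAC ler_pdivlMr// -exprSr.
rewrite -ler_pdivrMl ?ltr0n ?fact_gt0// mulrC.
by apply: le_trans (expR_ge1Dxn k (ltW x0)); rewrite lerDr.
Unshelve. all: by end_near. Qed.

Lemma continuous_expr_expRN (R : realType) k :
  continuous (fun x : R => x ^+ k * expR (- x)).
Proof.
move=> x; apply: cvgM; first exact: exprn_continuous.
apply: continuous_comp; [exact: opp_continuous|exact: continuous_expR].
Qed.

(** Integration by parts: the primitive for [k+1] is [k+1] times the one for
    [k], minus [x^(k+1) e^-x]. *)
Lemma primitive_expr_expRN (R : realType) k : exists F : R -> R,
  [/\ forall x : R, is_derive x 1 F (x ^+ k * expR (- x)),
      F x @[x --> +oo] --> 0 & F 0 = - k`!%:R].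
Proof.
elim: k => [|k [F [dF F0 FE]]].
  exists (fun x => - expR (- x)); split; last by rewrite oppr0 expR0.
    by move=> x; apply: is_derive_eq; ring.
  by rewrite -oppr0; apply: cvgN; exact: cvgr_expR.
exists (fun x => k.+1%:R * F x - x ^+ k.+1 * expR (- x)); split.
- move=> x.
  have dG : is_derive x 1 (fun x : R => x ^+ k.+1 * expR (- x))
      (k.+1%:R * (x ^+ k * expR (- x)) - x ^+ k.+1 * expR (- x)).
    have dX : is_derive x 1 (fun x : R => x ^+ k.+1) (k.+1%:R * x ^+ k).
      have := @is_derive_poly R 'X^(k.+1) x.
      rewrite derivXn hornerMn hornerXn -mulr_natl.
      rewrite (_ : horner _ = fun x => x ^+ k.+1)//.
      by apply/funext => y; rewrite hornerXn.
    have dE : is_derive x 1 (fun x : R => expR (- x)) (- expR (- x)).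
      by apply: is_derive_eq; rewrite mulrN1.
    by apply: is_derive_eq (is_deriveM dX dE) _; rewrite /GRing.scale/=; ring.
  apply: is_derive_eq (is_deriveB (is_deriveZ k.+1%:R (dF x)) dG) _.
  by rewrite /GRing.scale/= opprB addrC subrK.
- rewrite -[nbhs 0]/(nbhs (0 : R)) -(subr0 0).
  apply: cvgB; last exact: cvg_expr_expRN.
  by rewrite -(mulr0 k.+1%:R); apply: cvgMr.
- by rewrite FE expr0n mul0r subr0 mulrN -natrM -factS.
Qed.

Lemma integral_expr_expRN (R : realType) k :
  (\int[@lebesgue_measure R]_(x in `]0%R, +oo[) (x ^+ k * expR (- x))%:E
   = (k`!%:R)%:E)%E.
Proof.
have [F [dF Fy F0]] := primitive_expr_expRN R k.
have c := @continuous_expr_expRN R k.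
have cF : continuous F.
  move=> x; apply: differentiable_continuous; apply/derivable1_diffP.
  by have [] := dF x.
rewrite integral_itv_obnd_cbnd; last first.
  apply/measurable_EFinP; apply/measurable_funTS.
  exact: continuous_measurable_fun.
rewrite (@ge0_continuous_FTC2y _ _ F _ 0)//.
- by rewrite F0 EFinN oppeK add0e.
- by move=> x x0; rewrite mulr_ge0 ?exprn_ge0 ?expR_ge0.
- exact: continuous_subspaceT.
- by apply: cvg_at_right_filter; exact: cF.
- by move=> x _; rewrite derive1E derive_val.
Qed.

Lemma integrable_poly_expRN (R : realType) (p : {poly R}) :
  (@lebesgue_measure R).-integrable `]0, +oo[
    (EFin \o (fun x : R => p.[x] * expR (- x))).
Proof.
have intX k : (@lebesgue_measure R).-integrable `]0, +oo[
    (EFin \o (fun x : R => x ^+ k * expR (- x))).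
  apply/integrableP; split.
    apply/measurable_EFinP; apply: measurable_funTS.
    by apply: continuous_measurable_fun; exact: continuous_expr_expRN.
  under eq_integral => x.
    rewrite inE/= in_itv/= andbT => x0.
    rewrite ger0_norm; last by rewrite mulr_ge0 ?exprn_ge0 ?expR_ge0 ?(ltW x0).
    over.
  by rewrite integral_expr_expRN ltry.
rewrite (_ : _ \o _ = fun x : R =>
  \sum_(i < size p) (p`_i)%:E * (x ^+ i * expR (- x))%R%:E)%E.
  by apply: integrable_sum => // i _; apply: integrableZl => //; exact: intX.
apply/funext => x /=; rewrite horner_coef mulr_suml sumEFin; congr EFin.
by apply: eq_bigr => i _; rewrite mulrA.
Qed.

Definition exp_moment {R : realType} (p : {poly R}) : R :=
  \int[@lebesgue_measure R]_(x in `]0, +oo[) (p.[x] * expR (- x)).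

Lemma exp_moment_is_scalar (R : realType) : scalar (@exp_moment R).
Proof.
move=> a p q; rewrite /exp_moment.
rewrite -RintegralZl//; last exact: integrable_poly_expRN.
rewrite -RintegralD//; first last.
- exact: integrable_poly_expRN.
- rewrite (_ : _ \o _ = fun x : R => a%:E * (p.[x] * expR (- x))%R%:E)%E.
    by apply: integrableZl => //; exact: integrable_poly_expRN.
  by apply/funext => x.
by apply: eq_Rintegral => x _; rewrite hornerD hornerZ mulrDl mulrA.
Qed.
HB.instance Definition _ (R : realType) :=
  GRing.isLinear.Build R {poly R} R *%R (@exp_moment R)
    (@exp_moment_is_scalar R).

Lemma exp_momentXn (R : realType) k : exp_moment ('X^k : {poly R}) = k`!%:R.
Proof.
rewrite /exp_moment /Rintegral -[RHS]/(fine (k`!%:R)%:E).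
rewrite -(integral_expr_expRN R k); congr fine.
by apply: eq_integral => x _; rewrite hornerXn.
Qed.

Lemma mudens_nat (R : realType) k (x : R) : 0 < x ->
  mudens k%:R x = x ^+ k * expR (- x).
Proof. by move=> x0; rewrite /mudens powR_mulrn// ltW. Qed.

Lemma EulerGamma_nat (R : realType) (alpha : nat) : (0 < alpha)%N ->
  EulerGamma (alpha%:R : R) = (alpha.-1)`!%:R.
Proof.
move=> alpha0; rewrite -exp_momentXn; apply: eq_Rintegral => x.
rewrite inE/= in_itv/= andbT => x0.
have -> : alpha%:R - 1 = (alpha.-1)%:R :> R by rewrite -subn1 natrB.
by rewrite powR_mulrn ?hornerXn// ltW.
Qed.

Local Close Scope classical_set_scope.

(** * Generalized binomial coefficients and Pochhammer symbols *)

Lemma gbinom0 (R : realType) (y : R) : gbinom y 0 = 1.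
Proof. by rewrite /gbinom big_ord0 divr1. Qed.

Lemma gbinomS (R : realType) (y : R) k :
  k.+1%:R * gbinom y k.+1 = (y - k%:R) * gbinom y k.
Proof.
rewrite /gbinom big_ord_recr/= factS natrM.
have kS0 : k.+1%:R != 0 :> R by rewrite pnatr_eq0.
by field; rewrite factr_neq0 nat1r kS0.
Qed.

(** Multiply by [n+1], split it as [j + (n+1-j)] in each term, and apply the
    recurrence [gbinomS] to one of the two factors. *)
Lemma gbinom_Vandermonde (R : realType) (x y : R) n :
  \sum_(j < n.+1) gbinom x j * gbinom y (n - j) = gbinom (x + y) n.
Proof.
elim: n => [|n IHn]; first by rewrite big_ord1 !gbinom0 mulr1.
apply: (mulfI (_ : n.+1%:R != 0)); first by rewrite pnatr_eq0.
rewrite gbinomS -IHn mulr_sumr mulr_sumr.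
transitivity (\sum_(j < n.+2) j%:R * gbinom x j * gbinom y (n.+1 - j)
   + \sum_(j < n.+2) gbinom x j * ((n.+1 - j)%:R * gbinom y (n.+1 - j))).
  rewrite -big_split; apply: eq_bigr => j _ /=.
  by rewrite natrB -1?ltnS//; ring.
rewrite big_ord_recl [X in _ + X]big_ord_recr /=.
rewrite !mul0r add0r subnn mul0r mulr0 addr0.
rewrite -big_split; apply: eq_bigr => j _ /=.
by rewrite subSS subSn -1?ltnS// !gbinomS natrB -1?ltnS//; ring.
Qed.

Lemma gbinom_nat (R : realType) n k : gbinom (n%:R : R) k = 'C(n, k)%:R.
Proof.
elim: k => [|k IHk]; first by rewrite gbinom0 bin0.
apply: (mulfI (_ : k.+1%:R != 0)); first by rewrite pnatr_eq0.
rewrite gbinomS IHk -natrM mul_bin_left natrM.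
have [kn|nk] := leqP k n; first by rewrite natrB.
by rewrite bin_small// !mulr0.
Qed.

Lemma gbinom_sym (R : realType) n k :
  gbinom ((n + k)%:R : R) n = gbinom ((n + k)%:R : R) k.
Proof. by rewrite !gbinom_nat -bin_sub ?leq_addr// addKn. Qed.

Lemma gbinomN (R : realType) r j :
  gbinom (- (r.+1%:R) : R) j = (-1) ^+ j * 'C(r + j, j)%:R.
Proof.
elim: j => [|j IHj]; first by rewrite gbinom0 bin0 mulr1.
apply: (mulfI (_ : j.+1%:R != 0)); first by rewrite pnatr_eq0.
rewrite gbinomS IHj [RHS]mulrCA -natrM addnS -mul_bin_diag natrM exprS /=.
by rewrite -[r.+1]addn1 -[(r + j).+1]addn1 !natrD; ring.
Qed.

Lemma poch_gbinom (R : realType) (a : R) k :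
  poch a k = (-1) ^+ k * k`!%:R * gbinom (- a) k.
Proof.
rewrite /gbinom -mulrA [X in _ * X]mulrC mulfVK ?factr_neq0//.
rewrite -[in (-1) ^+ k](card_ord k) -prodr_const -big_split /=.
by apply: eq_bigr => i _; rewrite mulN1r opprD !opprK.
Qed.

Lemma poch_nat (R : realType) c l :
  poch (c.+1%:R : R) l * c`!%:R = (c + l)`!%:R.
Proof.
elim: l => [|l IHl]; first by rewrite /poch big_ord0 mul1r addn0.
rewrite /poch big_ord_recr/= mulrAC IHl addnS factS natrM -natrD addSn.
by rewrite mulrC.
Qed.

Lemma poch_ffact (R : realType) i k :
  poch (i%:R - k%:R + 1 : R) k = (i ^_ k)%:R.
Proof.
rewrite -bin_ffact natrM -gbinom_nat /gbinom mulfVK ?factr_neq0//.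
rewrite /poch (reindex_inj rev_ord_inj); apply: eq_bigr => j _ /=.
by rewrite natrB// -addn1 natrD; ring.
Qed.

(** The coefficient attached to [x^i] by the form is thus the one produced by
    differentiating [x^i] [xiM] times; in particular it vanishes when
    [i + alpha < m]. *)
Lemma poch_xiM (R : realType) (i m alpha : nat) :
  poch (i%:R - m%:R + alpha%:R + 1 : R) (xiM m alpha) = (i ^_ xiM m alpha)%:R.
Proof.
have [mal|alm] := leqP m alpha; rewrite /xiM.
  by rewrite (eqP mal) /poch big_ord0 ffactn0.
by rewrite -poch_ffact natrB 1?ltnW// opprB addrA addrAC.
Qed.

Lemma sum_ord_eq0_widen (V : nmodType) (m n : nat) (F : nat -> V) :
  (m <= n)%N -> (forall i, (m <= i)%N -> F i = 0) ->
  \sum_(i < n) F i = \sum_(i < m) F i.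
Proof.
move=> mn F0; rewrite (big_ord_widen _ _ mn) [RHS]big_mkcond.
by apply: eq_bigr => i _; case: ltnP => // /F0.
Qed.

(** * Moments of the Laguerre polynomials *)

Lemma laguerreE (R : realType) (a : R) (n : nat) :
  laguerre a n =
    \poly_(j < n.+1) ((-1) ^+ j / j`!%:R * gbinom (n%:R + a) (n - j)).
Proof.
rewrite /laguerre poly_def; apply: eq_bigr => j _.
by rewrite -[- 'X]scaleN1r exprZn scalerA; congr (_ *: _); ring.
Qed.

Lemma size_laguerre (R : realType) (a : R) (n : nat) :
  (size (laguerre a n) <= n.+1)%N.
Proof. by rewrite laguerreE size_poly. Qed.

Lemma laguerre_subz (R : realType) (a : R) (n j : nat) :
  laguerre a (n%:Z - j%:Z) = if (j <= n)%N then laguerre a (n - j)%N else 0.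
Proof.
have [jn|nj] := leqP j n; first by rewrite subzn.
by have -> : n%:Z - j%:Z = Negz (j - n).-1 by rewrite NegzE; lia.
Qed.

(** Upper negation turns [(r+j)! / j!] into [r! (-1)^j binom(-r-1,j)], so the
    sum over the coefficients is a Vandermonde convolution. *)
Lemma exp_moment_laguerre (R : realType) (a : R) (n r : nat) :
  exp_moment (laguerre a n * 'X^r) = r`!%:R * gbinom (n%:R + a - r.+1%:R) n.
Proof.
rewrite laguerreE poly_def mulr_suml linear_sum /=.
rewrite [n%:R + a - _]addrC -gbinom_Vandermonde mulr_sumr.
apply: eq_bigr => j _.
rewrite -scalerAl -exprD linearZ /= exp_momentXn gbinomN.
have -> : ((j + r)`!%:R : R) = 'C(r + j, j)%:R * j`!%:R * r`!%:R.
  have := bin_fact (leq_addl r j); rewrite addnK => E.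
  by rewrite -!natrM -mulnA E addnC.
by field; exact: factr_neq0.
Qed.

(** This is [Gamma(alpha)] times the distribution
    [x_+^(alpha-l-1) e^-x / Gamma(alpha-l)], analytically continued through the
    poles of Gamma: there it is a derivative of order [l-alpha] of the delta
    at 0, multiplied by [e^-x]. *)
Definition gamma_power {R : realType} (alpha l : nat) (p : {poly R}) : R :=
  if (l < alpha)%N then
    poch (alpha%:R - l%:R) l * exp_moment (p * 'X^(alpha - l.+1))
  else
    (alpha.-1)`!%:R
      * \sum_(j < (l - alpha).+1) p`_j * poch (alpha%:R - l%:R) j.

Lemma gamma_power_is_scalar (R : realType) alpha l :
  scalar (@gamma_power R alpha l).
Proof.
move=> a p q; rewrite /gamma_power; case: ifP => _.
  by rewrite mulrDl -scalerAl linearP /= mulrDr mulrCA.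
rewrite mulrCA -mulrDr; congr (_ * _); rewrite mulr_sumr -big_split.
by apply: eq_bigr => j _ /=; rewrite coefD coefZ mulrDl mulrA.
Qed.
HB.instance Definition _ (R : realType) alpha l :=
  GRing.isLinear.Build R {poly R} R *%R (@gamma_power R alpha l)
    (@gamma_power_is_scalar R alpha l).

(** For [l < alpha] this is a moment of the Laguerre polynomial; for
    [l >= alpha] it is the Vandermonde convolution of [binom(l-alpha,j)] with
    [binom(n+alpha,n-j)].  One formula covers both cases, as analytic
    continuation in [alpha - l] predicts. *)
Lemma gamma_power_laguerre (R : realType) (alpha l n : nat) : (0 < alpha)%N ->
  gamma_power alpha l (laguerre alpha%:R n : {poly R}) =
  (alpha.-1)`!%:R * gbinom (n%:R + l%:R) l.
Proof.
move=> alpha0; rewrite /gamma_power; case: ltnP => [lal|all].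
  rewrite exp_moment_laguerre mulrA.
  have -> : alpha%:R - l%:R = (alpha - l.+1).+1%:R :> R.
    by rewrite -natrB ?(ltnW lal)// subnSK.
  rewrite poch_nat (_ : (alpha - l.+1 + l = alpha.-1)%N); last by lia.
  rewrite subnSK// natrB ?(ltnW lal)//.
  by rewrite opprB addrACA subrr addr0 -natrD gbinom_sym.
congr (_ * _).
have pochE j : poch (alpha%:R - l%:R : R) j =
    (-1) ^+ j * j`!%:R * gbinom (l%:R - alpha%:R) j.
  by rewrite poch_gbinom opprB.
pose F j : R :=
  (laguerre alpha%:R n : {poly R})`_j * poch (alpha%:R - l%:R) j.
(* The summand vanishes both beyond l - alpha and beyond n, so that either
   bound of summation may be used. *)
rewrite -(@sum_ord_eq0_widen _ _ (l - alpha + n).+1 F); first last.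
- by move=> j lj; rewrite /F pochE -natrB// gbinom_nat bin_small ?mulr0.
- by rewrite ltnS leq_addr.
rewrite (@sum_ord_eq0_widen _ n.+1 _ F); first last.
- move=> j nj; rewrite /F nth_default ?mul0r//.
  by rewrite (leq_trans (size_laguerre _ _)).
- by rewrite ltnS leq_addl.
have -> : gbinom (n%:R + l%:R : R) l =
    gbinom ((l%:R - alpha%:R) + (n%:R + alpha%:R)) n.
  by rewrite -natrD -gbinom_sym natrD; congr gbinom; ring.
rewrite -gbinom_Vandermonde; apply: eq_bigr => j _.
rewrite /F laguerreE coef_poly ltn_ord pochE.
have sq : (-1) ^+ j * (-1) ^+ j = 1 :> R.
  by rewrite -exprMn mulrNN mulr1 expr1n.
transitivity ((-1) ^+ j * (-1) ^+ j
  * (gbinom (l%:R - alpha%:R) j * gbinom (n%:R + alpha%:R) (n - j)) : R).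
  by field; exact: factr_neq0.
by rewrite sq mul1r.
Qed.

Definition R_functional {R : realType} (alpha : nat) (w : nat -> nat -> R)
    (g : nat) (p : {poly R}) : R :=
  \sum_(l < g.+1) w g l * gamma_power alpha l p.

Lemma R_functional_is_scalar (R : realType) alpha (w : nat -> nat -> R) g :
  scalar (R_functional alpha w g).
Proof.
move=> a p q; rewrite /R_functional mulr_sumr -big_split.
by apply: eq_bigr => l _ /=; rewrite linearP /= mulrDr mulrCA.
Qed.
HB.instance Definition _ (R : realType) alpha (w : nat -> nat -> R) g :=
  GRing.isLinear.Build R {poly R} R *%R (R_functional alpha w g)
    (R_functional_is_scalar alpha w g).

Lemma R_functional_laguerre (R : realType) (G : seq nat) (Rg : nat -> {poly R})
    (alpha : nat) (w : nat -> nat -> R) (g n : nat) :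
  (0 < alpha)%N -> binom_expansion G Rg w -> g \in G ->
  R_functional alpha w g (laguerre alpha%:R n) =
  (alpha.-1)`!%:R * (Rg g).[n%:R].
Proof.
move=> alpha0 hw gG; rewrite hw// mulr_sumr; apply: eq_bigr => l _.
by rewrite gamma_power_laguerre// mulrCA.
Qed.

(** * Reduction of the bilinear form *)

Lemma derivn_mulXn (R : realType) (alpha m N : nat) (q : {poly R}) :
  (size q <= N)%N ->
  q^`(xiM m alpha) * 'X^(xim m alpha) =
  \sum_(i < N) (q`_i * (i ^_ xiM m alpha)%:R) *: 'X^(i + alpha - m).
Proof.
move=> qN; have qE : q = \sum_(i < N) q`_i *: 'X^i.
  rewrite -{1}(coefK q) poly_def.
  rewrite -(@sum_ord_eq0_widen _ _ N (fun j => q`_j *: 'X^j))// => j pj.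
  by rewrite nth_default// scale0r.
rewrite {1}qE linear_sum mulr_suml; apply: eq_bigr => i _ /=.
rewrite linearZ /= derivnXn -scaler_nat scalerA -scalerAl -exprD.
have [ik|ki] := ltnP i (m - alpha).
  by rewrite ffact_small// mulr0 !scale0r.
by congr (_ *: 'X^_); rewrite /xiM /xim; lia.
Qed.

Lemma regular_integral (R : realType) (alpha m N : nat) (p q : {poly R}) :
  (size q <= N)%N ->
  \int[@lebesgue_measure R]_(x in `]0, +oo[%classic)
     (p.[x] * (q^`(xiM m alpha)).[x] * mudens (xim m alpha)%:R x) =
  \sum_(i < N)
    q`_i * (i ^_ xiM m alpha)%:R * exp_moment (p * 'X^(i + alpha - m)).
Proof.
move=> qN.
transitivity (exp_moment (p * (q^`(xiM m alpha) * 'X^(xim m alpha)))).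
  apply: eq_Rintegral => x; rewrite inE/= in_itv/= andbT => x0.
  by rewrite mudens_nat// !hornerM hornerXn !mulrA.
rewrite (derivn_mulXn _ _ qN) mulr_sumr linear_sum.
by apply: eq_bigr => i _ /=; rewrite -scalerAr linearZ.
Qed.

Lemma singular_term (R : realType) (alpha m i : nat) (x : R) : 0 < x ->
  (i ^_ xiM m alpha)%:R * (- x ^ (i%:Z - m%:Z) / m%:R) * x ^+ alpha =
  - (i ^_ xiM m alpha)%:R / m%:R * x ^+ (i + alpha - m).
Proof.
move=> x0; have [im|mi] := ltnP (i + alpha) m.
  (* The exponent is truncated here, but its coefficient vanishes. *)
  by rewrite ffact_small ?oppr0 ?mul0r// /xiM; lia.
have -> : x ^+ (i + alpha - m) = x ^ (i%:Z - m%:Z) * x ^+ alpha.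
  by rewrite !exprnP -expfzDr ?gt_eqF//; congr (_ ^ _); lia.
by rewrite !mulNr mulrN mulNr; congr (- _); ring.
Qed.

Lemma regular_term (R : realType) (alpha l : nat) (x : R) :
  0 < x -> (l < alpha)%N ->
  x ^ (- l%:Z - 1) * x ^+ alpha = x ^+ (alpha - l.+1).
Proof.
by move=> x0 lal; rewrite !exprnP -expfzDr ?gt_eqF//; congr (_ ^ _); lia.
Qed.

(** The factor that multiplies [e^-x] in the second integral of the form.  Since
    [l <= g], the condition [l < alpha] gives the range of [U] when
    [g < alpha] and that of [V] when [alpha <= g]. *)
Definition side_poly {R : realType} (alpha : nat) (G : seq nat)
    (w kappa : nat -> nat -> R) (i : nat) : {poly R} :=
  \sum_(g <- G) kappa i g *:
    \sum_(l < g.+1 | (l < alpha)%N)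
      (poch (alpha%:R - l%:R) l * w g l) *: 'X^(alpha - l.+1)
  - (i ^_ xiM (size G) alpha)%:R *: 'X^(i + alpha - size G).

Lemma side_integrand (R : realType) (alpha : nat) (G : seq nat)
    (w kappa : nat -> nat -> R) (i : nat) (x : R) : (0 < size G)%N -> 0 < x ->
  (\sum_(g <- G | (g < alpha)%N) Ufun alpha (size G) w kappa i g x
   + \sum_(g <- G | (alpha <= g)%N) Vfun alpha (size G) w kappa i g x)
    * mudens alpha%:R x
  = (side_poly alpha G w kappa i).[x] * expR (- x).
Proof.
move=> m0 x0; rewrite mudens_nat// mulrA; congr (_ * _).
pose T g : R := \sum_(l < g.+1 | (l < alpha)%N)
  (poch (alpha%:R - l%:R) l * w g l) * x ^+ (alpha - l.+1).
pose s : R := - (i ^_ xiM (size G) alpha)%:R / (size G)%:R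
  * x ^+ (i + alpha - size G).
transitivity (\sum_(g <- G) (s + kappa i g * T g)).
  rewrite mulrDl !mulr_suml [RHS](bigID (fun g => g < alpha)%N) /=.
  congr (_ + _).
    apply: eq_bigr => g gal; rewrite /Ufun poch_xiM mulrDl singular_term//.
    congr (_ + _); rewrite -mulrA; congr (_ * _); rewrite mulr_suml /T.
    rewrite [RHS]big_mkcond; apply: eq_bigr => l _ /=.
    have lal : (l < alpha)%N by rewrite (leq_trans (ltn_ord l)).
    by rewrite lal -mulrA regular_term.
  under [RHS]eq_bigl do rewrite -leqNgt.
  apply: eq_bigr => g alg; rewrite /Vfun poch_xiM mulrDl singular_term//.
  congr (_ + _); rewrite -mulrA; congr (_ * _); rewrite mulr_suml /T.
  rewrite (big_ord_widen _ (fun l => poch (alpha%:R - l%:R) l * w g l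
    * x ^ (- l%:Z - 1) * x ^+ alpha) (leqW alg)).
  by apply: eq_bigr => l lal /=; rewrite -mulrA regular_term.
rewrite big_split /= big_const_seq count_predT iter_addr_0 addrC.
rewrite /side_poly hornerD hornerN hornerZ hornerXn; congr (_ + _).
  rewrite horner_sum; apply: eq_bigr => g _; rewrite hornerZ horner_sum.
  by congr (_ * _); apply: eq_bigr => l _; rewrite hornerZ hornerXn.
rewrite /s -[_ *+ size G]mulr_natr mulrAC.
by rewrite mulfVK ?pnatr_eq0 -?lt0n// mulNr.
Qed.

Lemma side_integral (R : realType) (alpha : nat) (G : seq nat)
    (w kappa : nat -> nat -> R) (i : nat) (p : {poly R}) : (0 < size G)%N ->
  \int[@lebesgue_measure R]_(x in `]0, +oo[%classic)
    (p.[x]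
     * (\sum_(g <- G | (g < alpha)%N) Ufun alpha (size G) w kappa i g x
        + \sum_(g <- G | (alpha <= g)%N) Vfun alpha (size G) w kappa i g x)
     * mudens alpha%:R x) =
  \sum_(g <- G) kappa i g
    * \sum_(l < g.+1 | (l < alpha)%N) w g l * gamma_power alpha l p
  - (i ^_ xiM (size G) alpha)%:R * exp_moment (p * 'X^(i + alpha - size G)).
Proof.
move=> m0; transitivity (exp_moment (p * side_poly alpha G w kappa i)).
  apply: eq_Rintegral => x; rewrite inE/= in_itv/= andbT => x0.
  by rewrite -mulrA side_integrand// hornerM mulrA.
rewrite /side_poly mulrBr linearB /= -scalerAr linearZ /=; congr (_ - _).
rewrite mulr_sumr linear_sum; apply: eq_bigr => g _ /=.
rewrite -scalerAr linearZ mulr_sumr linear_sum /=; congr (_ * _).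
apply: eq_bigr => l lal; rewrite -scalerAr linearZ /= /gamma_power lal.
by rewrite mulrA [w g l * _]mulrC.
Qed.

Lemma derivn_coef (R : realType) (q : {poly R}) i :
  (q^`(i)).[0] / i`!%:R = q`_i.
Proof.
rewrite horner_coef0 coef_derivn addn0 ffactnn -[_ *+ i`!]mulr_natr.
by rewrite mulfK// factr_neq0.
Qed.

(** Exchanging the sums over [j] and [l] shows that the discrete part of the
    form supplies the functionals [gamma_power alpha l] with [alpha <= l], which
    are missing from the integrals. *)
Lemma discrete_part (R : realType) (alpha g : nat) (w : nat -> nat -> R)
    (p : {poly R}) : (alpha <= g)%N ->
  (alpha.-1)`!%:R * \sum_(0 <= j < (g - alpha).+1) (p^`(j)).[0] / j`!%:R
     * \sum_(alpha + j <= l < g.+1) poch (alpha%:R - l%:R) j * w g l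
  = \sum_(l < g.+1 | (alpha <= l)%N) w g l * gamma_power alpha l p.
Proof.
move=> alg; pose F j l : R :=
  (alpha.-1)`!%:R * (p`_j * (poch (alpha%:R - l%:R) j * w g l)).
transitivity (\sum_(0 <= l < g.+1 | (alpha <= l)%N)
                \sum_(0 <= j < (g - alpha).+1 | (alpha + j <= l)%N) F j l).
  rewrite (exchange_big_dep_nat xpredT) //= mulr_sumr; apply: eq_bigr => j _.
  rewrite derivn_coef (big_nat_widenl _ 0)// !mulr_sumr.
  by apply: eq_bigl => l; case: (leqP alpha l); lia.
rewrite big_mkord; apply: eq_bigr => l all.
have lg : ((l - alpha).+1 <= (g - alpha).+1)%N by have := ltn_ord l; lia.
rewrite /gamma_power ltnNge all /= mulrCA mulr_sumr mulr_sumr.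
rewrite -(big_mkord xpredT (fun j => (alpha.-1)`!%:R
  * (w g l * (p`_j * poch (alpha%:R - l%:R) j)))).
rewrite (big_nat_widen _ _ _ _ _ lg).
apply: eq_big => [j|j _]; last by rewrite /F; ring.
by rewrite /=; lia.
Qed.

(** The terms of index [i < size G] of the first integral cancel against the
    singular summands of [U] and [V]. *)
Lemma xiformE (R : realType) (alpha : nat) (G : seq nat)
    (w kappa : nat -> nat -> R) (p q : {poly R}) (N : nat) :
  (0 < alpha)%N -> (0 < size G)%N -> (size q <= size G + N)%N ->
  xiform alpha G w kappa p q =
    \sum_(i < N) q`_(size G + i) * ((size G + i) ^_ xiM (size G) alpha)%:R
       * exp_moment (p * 'X^(i + alpha))
    + \sum_(i < size G) q`_i
       * \sum_(g <- G) kappa i g * R_functional alpha w g p.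
Proof.
move=> alpha0 m0 qN; rewrite /xiform (regular_integral _ _ _ qN).
rewrite big_split_ord /= EulerGamma_nat//.
under [X in _ + X + _ = _]eq_bigr
  do rewrite side_integral// derivn_coef mulrBr mulrA.
have cancel (a b s d : R) : a + b + (s - a) + d = b + (s + d) by ring.
rewrite sumrB cancel; congr (_ + _).
  by apply: eq_bigr => i _; congr (_ * exp_moment (_ * 'X^_)); lia.
rewrite mulr_sumr -big_split; apply: eq_bigr => i _ /=.
rewrite derivn_coef mulrCA -mulrDr; congr (_ * _).
rewrite mulr_sumr [X in _ + X]big_mkcond -big_split; apply: eq_bigr => g _ /=.
rewrite /R_functional [X in _ = _ * X](bigID (fun l : 'I_g.+1 => l < alpha)%N).
rewrite /= mulrDr; congr (_ + _).
under [X in _ = _ * X]eq_bigl do rewrite -leqNgt.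
case: ifP => alg; first by rewrite -discrete_part// mulrCA.
by rewrite big1 ?mulr0// => l; have := ltn_ord l; lia.
Qed.

(** * Expansion of the determinantal polynomials *)

Lemma det_col_mx1 (K : comPzRingType) m (u : 'rV[K]_(1 + m))
    (B : 'M[K]_(m, 1 + m)) :
  \det (col_mx u B) = \sum_j u 0 j * ((-1) ^+ j * \det (col' j B)).
Proof.
rewrite (expand_det_row _ (lshift m 0)); apply: eq_bigr => j _.
rewrite col_mxEu /cofactor add0n; congr (_ * (_ * \det _)).
have lift0 (i : 'I_m) : lift (lshift m (0 : 'I_1)) i = rshift 1 i.
  exact: val_inj.
by apply/matrixP => i k; rewrite mxE mxE lift0 col_mxEd mxE.
Qed.

Definition Rmx {R : realType} (G : seq nat) (Rg : nat -> {poly R}) (n : nat) :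
    'M[R]_(size G, 1 + size G) :=
  \matrix_(l < size G, j < 1 + size G) (Rg (nth 0%N G l)).[n%:R - j%:R].

Definition qcoef {R : realType} (G : seq nat) (Rg : nat -> {poly R}) (n : nat)
    (j : 'I_(1 + size G)) : R :=
  (-1) ^+ j * \det (col' j (Rmx G Rg n)).
Arguments qcoef {R} G Rg n j.

Lemma qdetE (R : realType) (a : R) (G : seq nat) (Rg : nat -> {poly R}) n :
  qdet a G Rg n = \sum_j qcoef G Rg n j *: laguerre a (n%:Z - (j : nat)%:Z).
Proof.
rewrite /qdet det_col_mx1; apply: eq_bigr => j _.
rewrite mxE mulrC -mul_polyC rmorphM rmorphXn rmorphN rmorph1 /= -det_map_mx.
by congr (_ * \det _ * _); apply/matrixP => i k; rewrite !mxE.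
Qed.

Lemma qcoef_orth (R : realType) (G : seq nat) (Rg : nat -> {poly R}) n g :
  g \in G -> \sum_j qcoef G Rg n j * (Rg g).[n%:R - j%:R] = 0.
Proof.
move=> gG; pose u := \row_(j < 1 + size G) (Rg g).[n%:R - j%:R].
have lG : (index g G < size G)%N by rewrite index_mem.
transitivity (\det (col_mx u (Rmx G Rg n))).
  by rewrite det_col_mx1; apply: eq_bigr => j _; rewrite mulrC mxE.
apply: (@determinant_alternate R _ _ (lshift _ ord0)
  (rshift 1 (Ordinal lG))) => //.
by move=> j; rewrite col_mxEu col_mxEd !mxE /= nth_index.
Qed.

Lemma qcoef_first (R : realType) (G : seq nat) (Rg : nat -> {poly R}) n :
  qcoef G Rg n ord0 = Omega G Rg n%:R.
Proof.
rewrite /qcoef expr0 mul1r; congr (\det _).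
by apply/matrixP => i j; rewrite !mxE.
Qed.

Lemma qcoef_last (R : realType) (G : seq nat) (Rg : nat -> {poly R}) n :
  qcoef G Rg n ord_max = (-1) ^+ size G * Omega G Rg n.+1%:R.
Proof.
rewrite /qcoef; congr (_ * \det _); apply/matrixP => i j.
rewrite !mxE lift_max; congr (_.[_]).
by rewrite -[n.+1]addn1 -[j.+1]addn1 !natrD; ring.
Qed.

Lemma ltn_size_ord_max m (j : 'I_m.+1) : j != ord_max -> (j < m)%N.
Proof.
move=> jm; rewrite ltn_neqAle -ltnS ltn_ord andbT.
by apply: contraNneq jm => jE; apply/eqP/val_inj.
Qed.

Lemma size_qdet (R : realType) (a : R) (G : seq nat) (Rg : nat -> {poly R}) n :
  (size (qdet a G Rg n) <= n.+1)%N.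
Proof.
rewrite qdetE; apply: (leq_trans (size_sum _ _ _)); apply/bigmax_leqP => j _.
apply: leq_trans (size_scale_leq _ _) _; rewrite laguerre_subz.
case: ifP => jn; last by rewrite size_poly0.
by apply: leq_trans (size_laguerre _ _) _; rewrite ltnS leq_subr.
Qed.

Lemma coef_qdet_top (R : realType) (a : R) (G : seq nat)
    (Rg : nat -> {poly R}) n :
  (qdet a G Rg n)`_n = Omega G Rg n%:R * ((-1) ^+ n / n`!%:R).
Proof.
rewrite qdetE coef_sum big_ord_recl -qcoef_first big1 ?addr0 => [|j _].
  by rewrite coefZ laguerreE coef_poly ltnS leqnn subnn gbinom0 mulr1.
rewrite coefZ laguerre_subz /=; case: ifP => jn; last by rewrite coef0 mulr0.
rewrite nth_default ?mulr0//; apply: leq_trans (size_laguerre _ _) _.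
by rewrite /bump /= in jn *; lia.
Qed.

(** * Orthogonality *)

(** By [qcoef_orth] the sum over [j <= n] that comes from the Laguerre expansion
    is minus the complementary one; there [n - j < 0]. *)
Lemma R_functional_qdet (R : realType) (G : seq nat) (Rg : nat -> {poly R})
    (alpha : nat) (w : nat -> nat -> R) (g n : nat) :
  (0 < alpha)%N -> binom_expansion G Rg w -> g \in G ->
  R_functional alpha w g (qdet alpha%:R G Rg n) =
  - (alpha.-1)`!%:R * \sum_(j < 1 + size G | (n < j)%N)
     qcoef G Rg n j * (Rg g).[n%:R - j%:R].
Proof.
move=> alpha0 hw gG; have := qcoef_orth Rg n gG.
rewrite (bigID (fun j : 'I_(1 + size G) => (n < j)%N)) /= => /eqP.
rewrite addr_eq0 => /eqP ->; rewrite mulrNN mulr_sumr qdetE linear_sum /=.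
rewrite [RHS]big_mkcond; apply: eq_bigr => j _.
rewrite linearZ /= laguerre_subz leqNgt if_neg; case: ifP => nj.
  by rewrite linear0 mulr0.
rewrite (R_functional_laguerre _ alpha0 hw gG).
by rewrite natrB 1?leqNgt ?nj// mulrCA.
Qed.

(** The moment of [L_(n-j)^alpha] with [x^(t+alpha)] is proportional to
    [binom(n-j-t-1,n-j)], which is 0 if [t + j < n] and a sign if [t + j = n];
    the latter requires [j = size G]. *)
Lemma exp_moment_qdet (R : realType) (G : seq nat) (Rg : nat -> {poly R})
    (alpha n t : nat) : (t + size G <= n)%N ->
  exp_moment (qdet alpha%:R G Rg n * 'X^(t + alpha)) =
  (t + size G == n)%N%:R
    * ((-1) ^+ t * (t + alpha)`!%:R * qcoef G Rg n ord_max).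
Proof.
move=> tn; rewrite qdetE mulr_suml linear_sum /=.
have moment (j : nat) : (j <= size G)%N ->
    exp_moment (laguerre alpha%:R (n%:Z - j%:Z) * 'X^(t + alpha)) =
    (t + j == n)%N%:R * ((-1) ^+ t * (t + alpha)`!%:R) :> R.
  move=> jm; rewrite laguerre_subz (leq_trans jm) ?(leq_trans _ tn) ?leq_addl//.
  rewrite exp_moment_laguerre.
  have [tj|tj] := eqVneq (t + j)%N n.
    have -> : (n - j)%:R + alpha%:R - (t + alpha).+1%:R = - (1%:R) :> R.
      by rewrite -[(t + alpha).+1]addn1 !natrD -tj addnK; ring.
    by rewrite gbinomN add0n binn mulr1 mul1r mulrC -tj addnK.
  have -> : (n - j)%:R + alpha%:R - (t + alpha).+1%:R = (n - j - t.+1)%:R :> R.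
    rewrite [RHS]natrB; last by lia.
    by rewrite -[t.+1]addn1 -[(t + alpha).+1]addn1 !natrD; ring.
  by rewrite gbinom_nat bin_small ?mulr0 ?mul0r//; lia.
rewrite (bigD1 ord_max) //= big1 ?addr0 => [|j /ltn_size_ord_max jm].
  by rewrite -scalerAl linearZ /= moment//; ring.
rewrite -scalerAl linearZ /= moment ?(ltnW jm)//.
by rewrite ltn_eqF ?mul0r ?mulr0// (leq_trans _ tn)// ltn_add2l.
Qed.

Lemma xiform_qdet_ge (R : realType) (G : seq nat) (Rg : nat -> {poly R})
    (alpha : nat) (w kappa : nat -> nat -> R) (n : nat) (q : {poly R}) :
  (0 < alpha)%N -> (0 < size G)%N -> binom_expansion G Rg w ->
  (size G <= n)%N -> (size q <= n.+1)%N ->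
  xiform alpha G w kappa (qdet alpha%:R G Rg n) q =
  q`_n * ((n ^_ xiM (size G) alpha)%:R *
     ((-1) ^+ (n - size G) * (n - size G + alpha)`!%:R
        * qcoef G Rg n ord_max)).
Proof.
move=> alpha0 m0 hw mn qn.
rewrite (@xiformE _ _ _ _ _ _ _ (n - size G).+1)//; last first.
  by rewrite addnS subnKC.
rewrite [X in _ + X]big1 ?addr0 => [|i _]; last first.
  rewrite big_seq big1 ?mulr0// => g gG.
  rewrite (R_functional_qdet _ alpha0 hw gG) big_pred0 ?mulr0// => j.
  by have := ltn_ord j; lia.
rewrite big_ord_recr /= big1 ?add0r => [|i _].
  by rewrite exp_moment_qdet ?subnK ?eqxx ?mul1r ?subnKC// -mulrA.
rewrite exp_moment_qdet; last by have := ltn_ord i; lia.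
by rewrite ltn_eqF ?mul0r ?mulr0//; have := ltn_ord i; lia.
Qed.

(** The indices [j > n] contribute the values of [sum_g kappa_i^g R_g] at
    [-(j-n)], with [1 <= j-n <= m-n].  For [i < n] all these values vanish by
    assumption; for [i = n] only the one at [j = m] survives. *)
Lemma xiform_qdet_lt (R : realType) (G : seq nat) (Rg : nat -> {poly R})
    (alpha : nat) (w kappa : nat -> nat -> R) (n : nat) (q : {poly R}) :
  (0 < alpha)%N -> binom_expansion G Rg w ->
  (forall i j, (i < size G)%N -> (1 <= j <= size G - 1 - i)%N ->
     \sum_(g <- G) kappa i g * (Rg g).[- j%:R] = 0) ->
  (n < size G)%N -> (size q <= n.+1)%N ->
  xiform alpha G w kappa (qdet alpha%:R G Rg n) q =
  q`_n * (- (alpha.-1)`!%:R * (qcoef G Rg n ord_max *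
     \sum_(g <- G) kappa n g * (Rg g).[- (size G)%:R + n%:R])).
Proof.
move=> alpha0 hw hk nm qn.
rewrite (@xiformE _ _ _ _ _ _ _ 0)//; first last.
- by rewrite addn0; exact: leq_trans nm.
- exact: leq_ltn_trans nm.
rewrite big_ord0 add0r.
have swap i :
    \sum_(g <- G) kappa i g * R_functional alpha w g (qdet alpha%:R G Rg n) =
    - (alpha.-1)`!%:R * \sum_(j < 1 + size G | (n < j)%N)
       qcoef G Rg n j * \sum_(g <- G) kappa i g * (Rg g).[- (j%:R) + n%:R].
  under [in RHS]eq_bigr do rewrite mulr_sumr.
  rewrite exchange_big /= mulr_sumr; apply: eq_big_seq => g gG.
  rewrite (R_functional_qdet _ alpha0 hw gG) mulrCA mulr_sumr; congr (_ * _).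
  by apply: eq_bigr => j _; rewrite mulrCA [- _ + _]addrC.
have kill i (j : 'I_(1 + size G)) :
    (n < j)%N -> (i <= n)%N -> (i + j < n + size G)%N ->
    \sum_(g <- G) kappa i g * (Rg g).[- (j%:R) + n%:R] = 0.
  move=> nj iln ij; have im : (i < size G)%N by lia.
  rewrite -[RHS](hk i (j - n)%N im); last by have := ltn_ord j; lia.
  by apply: eq_bigr => g _; rewrite natrB 1?ltnW// opprB addrC.
rewrite (bigD1 (Ordinal nm)) //= [X in _ + X]big1 ?addr0 => [|i ni].
  rewrite swap (bigD1 ord_max) //= [X in _ + X]big1 ?addr0// => j /andP[nj jm].
  by rewrite kill ?mulr0// ltn_add2l ltn_size_ord_max.
have {}ni : (i : nat) != n by apply: contraNneq ni => E; apply/eqP/val_inj.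
have [iln|nli] := leqP i n; last by rewrite nth_default ?mul0r// (leq_trans qn).
rewrite swap big1 ?mulr0// => j nj; rewrite kill ?mulr0//.
by have := ltn_ord j; lia.
Qed.

Theorem theorem5p3 (R : realType) (alpha : nat) (G : seq nat)
    (Rg : nat -> {poly R}) (w : nat -> nat -> R)
    (hm : (0 < size G)%N)
    (hsorted : sorted ltn G)
    (hpos : forall g : nat, g \in G -> (0 < g)%N)
    (hsize : forall g : nat, g \in G -> size (Rg g) = g.+1)
    (hlead : forall g : nat, g \in G -> lead_coef (Rg g) = (g`!%:R)^-1)
    (hw : binom_expansion G Rg w)
    (halpha : (0 < alpha)%N)
    (halphaG : (alpha <= \max_(g <- G) g)%N)
    (hOmega : forall n : nat, Omega G Rg n%:R <> 0) :
  (forall kappa : nat -> nat -> R,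
     (forall i : nat, (i < size G)%N ->
        (forall j : nat, (1 <= j <= size G - 1 - i)%N ->
           \sum_(g <- G) kappa i g * (Rg g).[- j%:R] = 0)
        /\ \sum_(g <- G) kappa i g * (Rg g).[- (size G)%:R + i%:R] <> 0) ->
     forall n : nat,
       (forall i : nat, (i < n)%N ->
          xiform alpha G w kappa
            (qdet alpha%:R G Rg n) (qdet alpha%:R G Rg i) = 0)
       /\ xiform alpha G w kappa
            (qdet alpha%:R G Rg n) (qdet alpha%:R G Rg n) <> 0)
  /\
  (forall kappa : nat -> nat -> R,
     forall n i : nat, (size G <= n)%N -> (i < n)%N ->
       xiform alpha G w kappa (qdet alpha%:R G Rg n) 'X^i = 0).
Proof.
have lead0 n : (qdet alpha%:R G Rg n)`_n != 0.
  rewrite coef_qdet_top !mulf_neq0 ?signr_eq0 ?invr_eq0 ?factr_neq0//.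
  exact/eqP.
have max0 n : qcoef G Rg n ord_max != 0.
  by rewrite qcoef_last mulf_neq0 ?signr_eq0//; apply/eqP.
split=> [kappa hk n|kappa n i mn iln]; last first.
  have Xi : (size ('X^i : {poly R}) <= n.+1)%N by rewrite size_polyXn ltnS ltnW.
  rewrite (xiform_qdet_ge kappa halpha hm hw mn Xi).
  by rewrite coefXn gtn_eqF ?mul0r.
suff [h h0 xiE] : exists2 h : R, h != 0 &
    forall q : {poly R}, (size q <= n.+1)%N ->
      xiform alpha G w kappa (qdet alpha%:R G Rg n) q = q`_n * h.
  split=> [i iln|].
    have si := size_qdet alpha%:R G Rg i.
    rewrite xiE ?(leq_trans si) ?ltnS ?(ltnW iln)//.
    by rewrite nth_default ?mul0r// (leq_trans si).
  by apply/eqP; rewrite xiE ?size_qdet// mulf_neq0.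
have [mn|nm] := leqP (size G) n.
  exists ((n ^_ xiM (size G) alpha)%:R * ((-1) ^+ (n - size G)
     * (n - size G + alpha)`!%:R * qcoef G Rg n ord_max)).
    have ff0 : (n ^_ xiM (size G) alpha)%:R != 0 :> R.
      by rewrite pnatr_eq0 -lt0n ffact_gt0 (leq_trans _ mn)// /xiM leq_subr.
    apply: (mulf_neq0 ff0 (mulf_neq0 (mulf_neq0 _ (factr_neq0 _ _)) (max0 n))).
    by rewrite signr_eq0.
  by move=> q; exact: xiform_qdet_ge.
exists (- (alpha.-1)`!%:R * (qcoef G Rg n ord_max *
     \sum_(g <- G) kappa n g * (Rg g).[- (size G)%:R + n%:R])).
  have k0 : \sum_(g <- G) kappa n g * (Rg g).[- (size G)%:R + n%:R] != 0.
    by apply/eqP; exact: (hk n nm).2.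
  by apply: (mulf_neq0 _ (mulf_neq0 (max0 n) k0)); rewrite oppr_eq0 factr_neq0.
by move=> q; apply: xiform_qdet_lt => // i j im; exact: (hk i im).1.
Qed.
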